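(* Let $(X,f,x_0)$ be a Dedekind system, let $\#$ be the unique iterator for $(X,f,x_0)$, and let $\mathcal{F}(X) = \{ A \subset X : A \text{ is finite} \}$. Then there exists a unique mapping $[\,\cdot\,] : X \to \mathcal{F}(X)$ with $[x_0] = \varnothing$ such that $[f(x)] = [x] \cup \{x\}$ for all $x \in X$. Moreover, $x \notin [x]$ for each $x \in X$, and $A \approx [\#(A)]$ holds for each finite set $A$. In particular, a set $A$ is finite if and only if $A \approx [x]$ for some $x \in X$.
   Context: For a set $A$ let $\mathcal{P}(A)$ denote its power set. A subset $\mathcal{K} \subset \mathcal{P}(A)$ is an inductive system in $\mathcal{P}(A)$ if $\varnothing \in \mathcal{K}$ and $B \cup \{a\} \in \mathcal{K}$ for all $B \in \mathcal{K}$ and $a \in A \setminus B$. A set $A$ is finite if $\mathcal{P}(A)$ itself is the only inductive system in $\mathcal{P}(A)$. Write $A \approx B$ if there exists a bijective mapping $h : A \to B$. A counting system is a triple $(X,f,x_0)$ with $X$ a set, $f : X \to X$ a mapping and $x_0 \in X$. A subset $Y \subset X$ is $f$-invariant if $f(Y) \subset Y$. The counting system is minimal if the only $f$-invariant subset of $X$ containing $x_0$ is $X$ itself; it is standard if $f$ is injective and $f(x) \ne x_0$ for all $x \in X$; it is a Dedekind system if it is both minimal and standard. An iterator for $(X,f,x_0)$ is an assignment $A \mapsto \#(A)$ of an element of $X$ to each finite set $A$ such that $\#(\varnothing) = x_0$ and $\#(A \cup \{a\}) = f(\#(A))$ whenever $A$ is a finite set and $a \notin A$. Each counting system has a unique iterator.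 *)

(* Defs.v *)
From mathcomp Require Import all_boot.
From mathcomp Require Import boolp classical_sets functions cardinality.

Set Implicit Arguments.
Unset Strict Implicit.
Unset Printing Implicit Defensive.

Local Open Scope classical_set_scope.

(* A set is rendered as a [set T] over an arbitrary type [T : Type]; the sets
   of set theory that are not given as subsets of anything are the [setT]'s. *)

Definition inductive_system (T : Type) (A : set T) (K : set (set T)) : Prop :=
  [/\ K `<=` [set B | B `<=` A],
      K set0 &
      forall (B : set T) (a : T), K B -> (A `\` B) a -> K (B `|` [set a])].

(* This is not the library's [finite_set], which is defined by a bijection
   with an initial segment of [nat]; no natural numbers are used here. *)
Definition is_finite (T : Type) (A : set T) : Prop :=
  forall K : set (set T), inductive_system A K -> K = [set B | B `<=` A].

(* As a type (via the coercion [set_type]) this is the type of finite subsets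
   of [T], with [sval] giving the underlying set. *)
Definition finite_subsets (T : Type) : set (set T) := [set A | is_finite A].
Arguments finite_subsets T : clear implicits.

Definition minimal_system (X : Type) (f : X -> X) (x0 : X) : Prop :=
  forall Y : set X, f @` Y `<=` Y -> Y x0 -> Y = setT.

Definition standard_system (X : Type) (f : X -> X) (x0 : X) : Prop :=
  injective f /\ forall x : X, f x <> x0.

Definition Dedekind_system (X : Type) (f : X -> X) (x0 : X) : Prop :=
  minimal_system f x0 /\ standard_system f x0.

(* The assignment ranges over the finite sets in all types at once. An element
   of [finite_subsets T] carries a finiteness proof, so "the value at the empty
   set" and "the value at A u {a}" are expressed by equations between the
   underlying sets. *)
Definition iterator (X : Type) (f : X -> X) (x0 : X)
    (it : forall T : Type, finite_subsets T -> X) : Prop :=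
  (forall (T : Type) (A : finite_subsets T), sval A = set0 -> it T A = x0) /\
  (forall (T : Type) (A B : finite_subsets T) (a : T),
     ~ sval A a -> sval B = sval A `|` [set a] -> it T B = f (it T A)).

(* Main.v *)
(* Iterating [f] from [x0] identifies a Dedekind system [X] with [nat]; [rank]
   is the inverse of this identification and [[x]] is the set of elements of
   rank smaller than that of [x]. Finiteness in the sense of inductive systems
   agrees with the library's [finite_set], so everything reduces to counting
   sets equipotent to [`I_n]. *)
Require Import Defs.
From mathcomp Require Import all_boot.
From mathcomp Require Import boolp classical_sets functions cardinality.

Set Implicit Arguments.
Unset Strict Implicit.
Unset Printing Implicit Defensive.

Local Open Scope classical_set_scope.
Local Open Scope card_scope.

(** Induction on [n]: a point is removed from [B], and closure of [K] under adjoining points of [A]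
    puts it back. *)
Lemma inductive_system_card (T : Type) (A : set T) (K : set (set T)) (n : nat)
    (B : set T) :
  inductive_system A K -> B `<=` A -> B #= `I_n -> K B.
Proof.
move=> [_ K0 KU]; elim: n B => [|n IHn] B BA.
  by rewrite II0 card_eq0 => /eqP ->.
move=> /eq_cardSP[x Bx Bxn].
rewrite -(setD1K Bx) setUC; apply: KU.
  by apply: IHn => // y [/BA].
by split; [exact: BA | case=> _; exact].
Qed.

Lemma is_finiteE (T : Type) (A : set T) : is_finite A <-> finite_set A.
Proof.
split=> [Afin | [n An] K Ksys].
  (* The test system consists of the subsets of [A] that are finite in the counting sense; it must
     be everything, hence contain [A] itself. *)
  have Ksys : inductive_system A [set B | B `<=` A /\ finite_set B].
    split=> [B [] // | | B a [BA Bfin] [Aa _]].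
      by split=> //; exact: finite_set0.
    split; first by move=> y [/BA // | ->].
    by rewrite finite_setU; split=> //; exact: finite_set1.
  have : [set B | B `<=` A] A by [].
  by rewrite -(Afin _ Ksys) => -[].
have [KA _ _] := Ksys.
apply/seteqP; split=> [//| B BA].
have /sub_finite_set/(_ (ex_intro _ n An)) [m Bm] := BA.
exact: inductive_system_card Ksys BA Bm.
Qed.

(** Each point removed from [A] strips one application of [f], until the empty set gives [x0]; so
    the iterator sees only the number of elements. *)
Lemma iterator_card (X : Type) (f : X -> X) (x0 : X)
    (it : forall T : Type, finite_subsets T -> X) (T : Type) (n : nat)
    (A : finite_subsets T) :
  iterator f x0 it -> sval A #= `I_n -> it T A = iter n f x0.
Proof.
move=> [it0 itS]; elim: n A => [|n IHn] A.
  by rewrite II0 card_eq0 => /eqP/it0.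
move=> /eq_cardSP[x Ax Axn].
have Axfin : sval A `\ x \in finite_subsets T.
  by rewrite inE; apply/is_finiteE; exists n.
rewrite (itS _ (SigSub Axfin) _ x) /= ?IHn //; first by case=> _; exact.
by rewrite setUC setD1K.
Qed.

Section DedekindSystem.
Variables (X : Type) (f : X -> X) (x0 : X) (hD : Dedekind_system f x0).

(** Minimality applied to [P], viewed as an [f]-invariant set containing [x0]. *)
Lemma minimal_system_ind (P : X -> Prop) :
  P x0 -> (forall x, P x -> P (f x)) -> forall x, P x.
Proof.
move=> P0 Pf x; have [hmin _] := hD.
suff : [set: X] x by rewrite -(hmin P) // => _ [y Py <-]; exact: Pf.
by [].
Qed.

(** Injectivity of [f] cancels one step on both sides; when one exponent reaches zero first, [x0]
    would be a value of [f]. *)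
Lemma iter_inj : injective (fun n => iter n f x0).
Proof.
have [_ [f_inj f_neq]] := hD.
elim=> [|m IHm] [|n] //=; first by move=> /esym/f_neq.
  by move=> /f_neq.
by move=> /f_inj/IHm ->.
Qed.

Lemma iter_surj (x : X) : exists n, iter n f x0 = x.
Proof.
elim/minimal_system_ind: x => [|x [n <-]]; first by exists 0.
by exists n.+1.
Qed.

Definition rank (x : X) : nat := sval (cid (iter_surj x)).

Lemma iter_rank (x : X) : iter (rank x) f x0 = x.
Proof. exact: svalP (cid (iter_surj x)). Qed.

Lemma rank_iter (n : nat) : rank (iter n f x0) = n.
Proof. by apply: iter_inj; rewrite /= iter_rank. Qed.

Lemma rank_inj : injective rank.
Proof. exact: can_inj iter_rank. Qed.

Lemma rankS (x : X) : rank (f x) = (rank x).+1.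
Proof. by rewrite -{1}(iter_rank x) -iterS rank_iter. Qed.

Definition segment (x : X) : set X := [set y | rank y < rank x].

Lemma segment0 : segment x0 = set0.
Proof.
by apply/seteqP; split=> // y; rewrite /segment /= (rank_iter 0) ltn0.
Qed.

Lemma segmentS (x : X) : segment (f x) = segment x `|` [set x].
Proof.
apply/seteqP; split=> y; rewrite /segment /= rankS.
  by rewrite ltnS leq_eqVlt => /orP[/eqP/rank_inj|]; [right | left].
by case=> [/ltnW|->]; rewrite ltnS.
Qed.

Lemma segment_irrefl (x : X) : ~ segment x x.
Proof. by rewrite /segment /= ltnn. Qed.

Lemma segment_card (n : nat) : segment (iter n f x0) #= `I_n.
Proof.
elim: n => [|n IHn]; first by rewrite segment0 II0 card_eq0.
apply/eq_cardSP; exists (iter n f x0); rewrite iterS segmentS; first by right.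
(* The adjoined point is new by [segment_irrefl], so deleting it recovers the previous segment,
   counted by [IHn]. *)
suff -> : (segment (iter n f x0) `|` [set iter n f x0]) `\ iter n f x0 =
          segment (iter n f x0) by [].
apply/seteqP; split=> [y [[]//]|y ys]; split; first by left.
by move=> /= yE; move: ys; rewrite yE => /segment_irrefl.
Qed.

Lemma segment_finite (x : X) : segment x \in finite_subsets X.
Proof.
rewrite inE; apply/is_finiteE; exists (rank x).
by rewrite -{1}(iter_rank x) segment_card.
Qed.

End DedekindSystem.

Theorem theorem3p4 (X : Type) (f : X -> X) (x0 : X)
    (hD : Dedekind_system f x0)
    (it : forall T : Type, finite_subsets T -> X)
    (hit : iterator f x0 it) :
  exists seg : X -> finite_subsets X,
    unique (fun s : X -> finite_subsets X =>
              sval (s x0) = set0 /\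
              forall x : X, sval (s (f x)) = sval (s x) `|` [set x]) seg /\
    (forall x : X, ~ sval (seg x) x) /\
    (forall (T : Type) (A : finite_subsets T),
        sval A #= sval (seg (it T A))) /\
    (forall (T : Type) (A : set T),
        is_finite A <-> exists x : X, A #= sval (seg x)).
Proof.
(* If [A] has [n] elements, its iterator value is the [n]-th iterate of [x0], whose segment also has
   [n] elements. *)
have it_card (T : Type) (A : finite_subsets T) :
    sval A #= segment hD (it T A).
  have [n An] : finite_set (sval A) by apply/is_finiteE/set_mem/(svalP A).
  rewrite (iterator_card hit An).
  by apply: card_eq_trans An _; rewrite card_eq_sym segment_card.
exists (fun x => SigSub (segment_finite hD x)).
split; [split=> [|s [s0 sS]] | split; [|split]].
- by split=> [|x]; [exact: segment0 | exact: segmentS].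
(* Uniqueness: agreement with [s] holds at [x0] and passes from [x] to [f x]; [val_inj] discards the
   finiteness proofs. *)
- apply/funext; apply: (minimal_system_ind hD) => [|x sx]; apply: val_inj => /=.
    by rewrite segment0 -s0.
  by rewrite segmentS [RHS]sS -sx.
- exact: segment_irrefl.
- exact: it_card.
- move=> T A; split=> [Afin | [x Ax]].
    have AF : A \in finite_subsets T by rewrite inE.
    by exists (it T (SigSub AF)); exact: (it_card T (SigSub AF)).
  apply/is_finiteE; exists (rank hD x); apply: card_eq_trans Ax _.
  by rewrite /= -{1}(iter_rank hD x) segment_card.
Qed.
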